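(* Let $M(x)=\sum_{n\ge 0}M_nx^n$ be the generating function of the Motzkin numbers and, for a positive integer $r$, let $F(x,r)=M(x)^r$. For every integer $n\ge 0$, $$H_n(F(x,2))=\begin{cases}1, & n\bmod 12\in\{0,1,2,3\},\\ 0, & n\bmod 12\in\{4,5,10,11\},\\ -1, & n\bmod 12\in\{6,7,8,9\}.\end{cases}$$ Moreover, for every integer $n\ge 0$, $$H_{3n}(F(x,3))=H_{3n+1}(F(x,3))=(-1)^n(n+1)^2,\qquad H_{3n+2}(F(x,3))=0.$$
   Context: The Motzkin numbers are $M_n=\sum_{k\ge 0}\binom{n}{2k}C_k$, where $C_k=\frac{1}{k+1}\binom{2k}{k}$ is the $k$-th Catalan number; equivalently $M(x)=\sum_{n\ge0}M_nx^n=\frac{1-x-\sqrt{1-2x-3x^2}}{2x^2}$. For a formal power series $A(x)=\sum_{n\ge 0}a_nx^n$, its Hankel determinants are $H_n(A(x))=\det(a_{i+j})_{0\le i,j\le n-1}$ for $n\ge1$, and $H_0(A(x))=1$. *)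

(* Defs.v *)
From mathcomp Require Import all_boot all_order all_algebra.

Set Implicit Arguments.
Unset Strict Implicit.
Unset Printing Implicit Defensive.

Import GRing.Theory.
Local Open Scope ring_scope.

(* A formal power series \sum_n a_n x^n is represented by n |-> a_n. *)
Definition fps (R : Type) : Type := nat -> R.

Definition fps_one (R : comNzRingType) : fps R := fun n => (n == 0)%:R.

Definition fps_mul (R : comNzRingType) (A B : fps R) : fps R :=
  fun n => \sum_(i < n.+1) A i * B (n - i)%N.

Definition fps_exp (R : comNzRingType) (A : fps R) (r : nat) : fps R :=
  iter r (fps_mul A) (fps_one R).

(* For n = 0 this is the determinant of the empty matrix, which is 1. *)
Definition hankel (R : comNzRingType) (A : fps R) (n : nat) : R :=
  \det (\matrix_(i < n, j < n) A (i + j)%N).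

Lemma hankel0 (R : comNzRingType) (A : fps R) : hankel A 0 = 1.
Proof. exact: det_mx00. Qed.

(* The division is exact: see catalanE. *)
Definition catalan (k : nat) : nat := ('C(2 * k, k) %/ k.+1)%N.

Lemma catalanE (k : nat) : (k.+1 * catalan k = 'C(2 * k, k))%N.
Proof.
rewrite /catalan mulnC divnK //.
rewrite -(@Gauss_dvdr _ k) ?coprimeSn //.
have := mul_bin_left (2 * k) k.
rewrite mul2n -addnn addnK => <-; exact: dvdn_mulr.
Qed.

(* 'C(n, 2 * k) = 0 for k > n, so the sum over all k >= 0 stops at k = n. *)
Definition motzkin (n : nat) : nat :=
  (\sum_(k < n.+1) 'C(n, 2 * k) * catalan k)%N.

Definition motzkin_fps : fps int := fun n => (motzkin n)%:Z.

(* F(x, r) = M(x)^r *)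
Definition motzkin_pow (r : nat) : fps int := fps_exp motzkin_fps r.

(* Main.v *)
(* Idea. Let J be the adjacency operator of the path 0 - 1 - 2 - ... with a loop
   at every vertex ([step 1]).  Motzkin numbers count closed walks at 0, and
   cutting a walk at last visits gives [x^n] M^(k+1) = <J^(n+k) e_k, e_0>.
   As J is symmetric, the Hankel matrix of M^(k+1) is T B^T, where the rows of
   T are the J^(i+k) e_k and those of the unitriangular B are the J^j e_0.
   The rows of T are banded and annihilated by every sequence W with
   (J^(m+k) W)_k = 0 for all m.  Given 2k such sequences, Christoffel's argument
   expresses the Hankel determinant by the 2k x 2k determinants of the values of
   the W's at 0, ..., 2k-1 and at n, ..., n+2k-1.  If p_0 = 1,
   p_1 = t - 1, p_2, ... are the polynomials with J p = t p, then the Taylor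
   coefficients of l |-> p_l at a root of t^k p_k, up to its multiplicity, are
   such sequences.  For k = 1 this polynomial is t (t - 1), for k = 2 it is
   t^3 (t - 2). *)
Require Import Defs.
From mathcomp Require Import all_boot all_order all_algebra all_fingroup.
From mathcomp Require Import zify ring.

Set Implicit Arguments.
Unset Strict Implicit.
Unset Printing Implicit Defensive.

Import GRing.Theory.
Local Open Scope ring_scope.

(** * Walks on the half line and the symmetric operator [step c] *)

Definition delta (k : nat) : nat -> int := fun l => (l == k)%:R.

(** The number [c] of loops at each vertex is kept variable: [c = 1] gives Motzkin paths and [c = 0]
    gives Dyck paths. *)
Definition step (c : nat) (f : nat -> int) : nat -> int :=
  fun l => (if l is l'.+1 then f l' else 0) + f l *+ c + f l.+1.

Definition walks (c n : nat) : nat -> int := iter n (step c) (delta 0).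
Arguments walks : simpl never.

Lemma sum_delta (N k : nat) (f : nat -> int) :
  (k < N)%N -> \sum_(l < N) delta k l * f l = f k.
Proof.
move=> ltkN; rewrite (bigD1 (Ordinal ltkN)) //= /delta eqxx mul1r big1 ?addr0 //.
by move=> i; rewrite -val_eqE /= => /negPf ->; rewrite mul0r.
Qed.

(** Truncating the symmetric operator at [N] leaves two boundary terms, with factors [f N] and
    [f (N - 1)]; the support hypothesis kills both. *)
Lemma step_adjoint (c N : nat) (f g : nat -> int) :
    (forall l, (N <= l.+1)%N -> f l = 0) ->
  \sum_(l < N) step c f l * g l = \sum_(l < N) f l * step c g l.
Proof.
case: N => [|N] f0; first by rewrite !big_ord0.
rewrite /step.
under eq_bigr do rewrite !mulrDl.
under [RHS]eq_bigr do rewrite !mulrDr.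
rewrite !big_split /= addrC [X in _ + X = _]addrC addrA.
congr (_ + _ + _).
- rewrite big_ord_recr big_ord_recl /= mulr0 add0r f0 // mul0r addr0.
  by apply: eq_bigr.
- by apply: eq_bigr => l _; rewrite mulrnAl mulrnAr.
- rewrite big_ord_recl big_ord_recr /= mul0r add0r f0 // mul0r addr0.
  by apply: eq_bigr.
Qed.

Lemma iter_step_out (c s m : nat) (f : nat -> int) :
    (forall l, (s < l)%N -> f l = 0) ->
  forall l, (s + m < l)%N -> iter m (step c) f l = 0.
Proof.
move=> f0; elim: m => [|m IH] l /= ltl; first by apply: f0; lia.
case: l ltl => [|l] ltl; first lia.
by rewrite /step !IH ?mul0rn ?addr0 //; lia.
Qed.

Lemma iter_step_lead (c s m : nat) (f : nat -> int) :
    (forall l, (s < l)%N -> f l = 0) -> iter m (step c) f (s + m)%N = f s.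
Proof.
move=> f0; elim: m => [|m IH]; first by rewrite addn0.
rewrite addnS /= /step IH !(iter_step_out _ f0) ?mul0rn ?addr0 //; lia.
Qed.

Lemma delta_out (k l : nat) : (k < l)%N -> delta k l = 0.
Proof. by rewrite /delta; case: eqP => //; lia. Qed.

Lemma iter_step_adjoint (c m N s : nat) (f g : nat -> int) :
    (forall l, (s < l)%N -> f l = 0) -> (s + m < N)%N ->
  \sum_(l < N) iter m (step c) f l * g l
    = \sum_(l < N) f l * iter m (step c) g l.
Proof.
move=> f0; elim: m g => [//|m IH] g ltN.
under [RHS]eq_bigr do rewrite iterSr.
rewrite -IH; last by lia.
rewrite /= step_adjoint // => l leN; apply: (iter_step_out _ f0); lia.
Qed.

Lemma sum_walks (c m n : nat) (f : nat -> int) :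
  (m < n)%N -> \sum_(l < n) walks c m l * f l = iter m (step c) f 0.
Proof.
move=> ltmn; rewrite (@iter_step_adjoint _ _ _ 0) ?sum_delta //; first lia.
exact: delta_out.
Qed.

(** Walks are reversible because the operator is symmetric. *)
Lemma walksE (c m k : nat) : walks c m k = iter m (step c) (delta k) 0.
Proof.
rewrite -(@sum_walks c m (maxn m k).+1); last lia.
under eq_bigr do rewrite mulrC.
by rewrite sum_delta //; lia.
Qed.

Lemma walks_out (c n k : nat) : (n < k)%N -> walks c n k = 0.
Proof. by move=> ?; apply: (@iter_step_out _ 0) => //; apply: delta_out. Qed.

Lemma walks_diag (c n : nat) : walks c n n = 1.
Proof. by rewrite /walks (@iter_step_lead _ 0) //; apply: delta_out. Qed.

Lemma walksS0 (c n : nat) :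
  walks c n.+1 0 = walks c n 0 *+ c + walks c n 1.
Proof. by rewrite {1}/walks iterS -/(walks c n) /step add0r. Qed.

Lemma walksSS (c n k : nat) :
  walks c n.+1 k.+1 = walks c n k + walks c n k.+1 *+ c + walks c n k.+2.
Proof. by rewrite {1}/walks iterS. Qed.

(** * Powers of a series that counts closed walks *)

(* A walk to height k + 1 is cut after its last visit to height 0. *)
Lemma walks_last_passage (c n k : nat) :
  \sum_(i < n.+1) walks c i 0 * walks c (n - i) k = walks c n.+1 k.+1.
Proof.
elim: n k => [|n IH] k.
  by rewrite big_ord1 mul1r walksSS !(walks_out _ (ltn0Sn _)) mul0rn !addr0.
rewrite big_ord_recr /= subnn [RHS]walksSS -!IH -sumrMnl.
have subS (i : 'I_n.+1) : (n.+1 - i = (n - i).+1)%N by rewrite subSn // -ltnS.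
case: k => [|k].
  under eq_bigr do rewrite subS walksS0 mulrDr mulrnAr.
  by rewrite big_split /= mulr1 addrC addrA.
rewrite [walks c 0 _]walks_out // mulr0 addr0 -IH.
under eq_bigr do rewrite subS walksSS !mulrDr mulrnAr.
by rewrite !big_split.
Qed.

Lemma fps_exp_walks (M : fps int) (c : nat) :
    (forall n, M n = walks c n 0) ->
  forall k n, fps_exp M k.+1 n = walks c (n + k) k.
Proof.
move=> ME; elim=> [|k IH] n.
  rewrite /= /fps_mul big_ord_recr /= subnn mulr1 addn0 big1 ?add0r ?ME //.
  by move=> i _; rewrite /fps_one; case: eqP; rewrite ?mulr0 //; have := ltn_ord i; lia.
have -> : fps_exp M k.+2 n = \sum_(i < n.+1) walks c i 0 * walks c (n - i + k) k.
  by apply: eq_bigr => i _; rewrite ME -IH.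
rewrite addnS -walks_last_passage.
(* The cut formula also has terms with [i > n]; there the remaining [n + k - i < k] steps cannot
   reach height [k]. *)
rewrite -addSn big_split_ord /= [X in _ = _ + X]big1 ?addr0 => [|i _].
  by apply: eq_bigr => i _; rewrite addnC addnBA 1?addnC // -ltnS.
by rewrite [X in _ * X]walks_out ?mulr0 //; have := ltn_ord i; lia.
Qed.

(** * Motzkin numbers count closed walks with one loop per vertex *)

(** One more loop at every vertex replaces J by J + 1, and (J + 1)^n expands binomially: [m] counts
    the steps that avoid the new loop. *)
Lemma walks_binomial (c n k : nat) :
  walks c.+1 n k = \sum_(m < n.+1) walks c m k *+ 'C(n, m).
Proof.
elim: n k => [|n IH] k; first by rewrite big_ord1.
have -> : \sum_(m < n.+2) walks c m k *+ 'C(n.+1, m)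
  = \sum_(m < n.+1) walks c m k *+ 'C(n, m)
    + \sum_(m < n.+1) walks c m.+1 k *+ 'C(n, m).
  rewrite big_ord_recl /= bin0.
  under eq_bigr do rewrite /bump /= add1n binS mulrnDr.
  rewrite big_split /= addrA; congr (_ + _).
  rewrite [in RHS]big_ord_recl big_ord_recr /= bin0 bin_small // mulr0n addr0.
  by congr (_ + _).
rewrite -IH; case: k => [|k].
  under eq_bigr do rewrite walksS0 mulrnDl mulrnAC.
  by rewrite big_split /= sumrMnl -!IH walksS0 mulrS addrA.
under eq_bigr do rewrite walksSS !mulrnDl [_ *+ c *+ _]mulrnAC.
rewrite !big_split /= sumrMnl -!IH walksSS mulrS; ring.
Qed.

(** These are the ballot numbers, [j] being the number of down-steps; Pascal's rule gives them the
    recursion of the walks. *)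
Lemma ballot (k j : nat) :
  walks 0 (k + j.*2) k + (if j is j'.+1 then 'C(k + j.*2, j') else 0)%:Z
    = 'C(k + j.*2, j)%:Z.
Proof.
move Em: (k + j.*2)%N => m.
elim: m k j Em => [|m IH] [|k] [|j] //= Em; try lia.
- have Em' : m = (1 + j.*2)%N by lia.
  have := IH 1%N j (esym Em'); rewrite walksS0 mulr0n add0r.
  (* At height 0 there is no step from below; since m = 2j + 1, symmetry of the two middle binomials
     makes up for it. *)
  have : 'C(m, j.+1) = 'C(m, j).
    by rewrite -[RHS]bin_sub; [congr 'C(_, _); lia | lia].
  by case: j {Em Em'} => [|j] /=; rewrite ?binS ?bin0; lia.
- have -> : m = k by lia.
  by rewrite walks_diag bin0.
- have H1 := IH k j.+1 ltac:(lia); have H2 := IH k.+2 j ltac:(lia).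
  rewrite walksSS mulr0n !binS.
  by case: j H1 H2 {Em} => [|j] /=; rewrite ?binS ?bin0; lia.
Qed.

Lemma walks_odd (m k : nat) : odd (m + k) -> walks 0 m k = 0.
Proof.
elim: m k => [|m IH] [|k] //=; rewrite ?walksS0 ?walksSS mulr0n oddD /= => H.
  by rewrite IH // oddD; case: odd H.
by rewrite !IH // oddD /=; move: H; case: (odd m); case: (odd k).
Qed.

Lemma walks_catalan (j : nat) : walks 0 j.*2 0 = (catalan j)%:Z.
Proof.
apply: (@mulfI _ j.+1%:Z) => //.
have := ballot 0 j; rewrite add0n.
have := catalanE j; rewrite mul2n.
case: j => [|j]; first by rewrite /= bin0; lia.
(* This relates the two neighbouring binomials of the ballot formula, whose difference is then the
   Catalan number. *)
have := mul_bin_left j.+1.*2 j.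
have -> : (j.+1.*2 - j = j.+2)%N by lia.
nia.
Qed.

Lemma big_double (n : nat) (f : nat -> int) :
  \sum_(m < n.*2) f m = \sum_(k < n) (f k.*2 + f k.*2.+1).
Proof.
elim: n => [|n IH]; first by rewrite !big_ord0.
by rewrite doubleS !big_ord_recr /= IH addrA.
Qed.

Lemma motzkin_walks (n : nat) : motzkin_fps n = walks 1 n 0.
Proof.
rewrite /motzkin_fps /motzkin walks_binomial.
(* The range is doubled so that the sum splits into pairs of an even and an odd index; the added
   binomials are 0. *)
have -> : \sum_(m < n.+1) walks 0 m 0 *+ 'C(n, m)
        = \sum_(m < n.+1.*2) walks 0 m 0 *+ 'C(n, m).
  rewrite -addnn big_split_ord /= [X in _ = _ + X]big1 ?addr0 // => i _.
  by rewrite bin_small //; lia.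
rewrite (big_double _ (fun m => walks 0 m 0 *+ 'C(n, m))) -natz natr_sum.
apply: eq_bigr => k _.
rewrite [walks 0 (k.*2).+1 0]walks_odd ?addn0 /= ?odd_double // mul0rn addr0.
by rewrite walks_catalan mul2n -[RHS]mulr_natr !natz mulnC PoszM.
Qed.

(** * Christoffel's argument for banded matrices, applied to Hankel matrices *)

(** An even power of the cyclic shift is a square, hence an even permutation. *)
Lemma det_rot_even (R : comNzRingType) (N d : nat) (g : nat -> nat -> R) :
    ~~ odd d ->
  \det (\matrix_(i < N, j < N) g ((i + d) %% N)%N j)
    = \det (\matrix_(i < N, j < N) g i j).
Proof.
move=> even_d; set A := \matrix_(i, j) g i j.
pose r : {perm 'I_N} := perm (@ordS_inj N).
have rE k i : nat_of_ord ((r ^+ k)%g i) = ((i + k) %% N)%N.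
  rewrite permX; elim: k => [|k IH] /=; first by rewrite addn0 modn_small ?ltn_ord.
  by rewrite permE /= IH -addn1 modnDml addn1 addnS.
have -> : (\matrix_(i < N, j < N) g ((i + d) %% N)%N j) = row_perm (r ^+ d)%g A.
  by apply/matrixP=> i j; rewrite !mxE rE.
rewrite row_permE det_mulmx det_perm.
have -> : odd_perm (r ^+ d)%g = false.
  rewrite -[d]odd_double_half (negPf even_d) add0n -muln2 expgM expgS expg1.
  by rewrite odd_permM addbb.
by rewrite mul1r.
Qed.

Lemma det_unitrig (R : comNzRingType) (n : nat) (f : nat -> nat -> R) :
    (forall i j, (i < j)%N -> f i j = 0) -> (forall i, f i i = 1) ->
  \det (\matrix_(i < n, j < n) f i j) = 1.
Proof.
move=> f0 f1; rewrite det_trig.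
  by rewrite big1 // => i _; rewrite mxE.
by apply/is_trig_mxP => i j lt; rewrite mxE f0.
Qed.

(* Multiply the matrix with rows T_0, ..., T_(n-1), e_n, ..., e_(n+d-1) by the one
   with columns e_d, ..., e_(n+d-1), W_0, ..., W_(d-1): both this product and the
   first factor are block triangular.  Evenness of d kills the sign of the
   rotation of rows that makes the second factor block triangular. *)
Lemma det_minor_annihilated (R : comNzRingType) (n d : nat)
    (T W : nat -> nat -> R) :
    ~~ odd d ->
    (forall i l, (i + d < l)%N -> T i l = 0) -> (forall i, T i (i + d)%N = 1) ->
    (forall i c, (i < n)%N -> (c < d)%N ->
       \sum_(l < n + d) T i l * W l c = 0) ->
  \det (\matrix_(i < d, c < d) W i c) * \det (\matrix_(i < n, j < n) T i j)
    = \det (\matrix_(i < d, c < d) W (n + i)%N c).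
Proof.
move=> even_d T0 T1 TW.
pose G := block_mx (\matrix_(i < n, j < n) T i j)
                   (\matrix_(i < n, j < d) T i (n + j)%N)
                   (0 : 'M_(d, n)) (1%:M : 'M_d).
pose g (i j : nat) : R := if (j < n)%N then (i == d + j)%:R else W i (j - n)%N.
pose V := \matrix_(i < n + d, j < n + d) g i j.
have detG : \det G = \det (\matrix_(i < n, j < n) T i j).
  by rewrite det_ublock det1 mulr1.
have detV : \det V = \det (\matrix_(i < d, c < d) W i c).
  rewrite /V -(@det_rot_even _ _ d) //.
  set V' := \matrix_(_, _) _.
  have -> : V' = block_mx 1%:M (\matrix_(i < n, j < d) W (i + d)%N j)
                   0 (\matrix_(i < d, c < d) W i c).
    apply/matrixP => i j; rewrite [LHS]mxE /g.
    case: (split_ordP i) => i' ->; case: (split_ordP j) => j' -> /=;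
      rewrite ?(block_mxEul, block_mxEur, block_mxEdl, block_mxEdr) !mxE
              ?ltn_ord 1?[(_ + j' < n)%N]ltnNge ?leq_addr /=.
    - by rewrite modn_small ?ltn_add2r // addnC eqn_add2l.
    - by rewrite modn_small ?ltn_add2r // addKn.
    - rewrite addnAC modnDl modn_small; last by have := ltn_ord i'; lia.
      by case: eqP => // eq_i'; have := ltn_ord i'; lia.
    - rewrite addnAC modnDl modn_small; last by have := ltn_ord i'; lia.
      by rewrite addKn.
  by rewrite det_ublock det1 mul1r.
have GV : G *m V = block_mx (\matrix_(i < n, j < n) T i (d + j)%N) 0
                    (\matrix_(i < d, j < n) (n + i == d + j)%:R)
                    (\matrix_(i < d, c < d) W (n + i)%N c).
  apply/matrixP => i j; rewrite [LHS]mxE.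
  case: (split_ordP i) => i' ->; case: (split_ordP j) => j' -> /=;
    rewrite ?(block_mxEul, block_mxEur, block_mxEdl, block_mxEdr) !mxE.
  - have -> : \sum_j0 G (lshift d i') j0 * V j0 (lshift d j')
            = \sum_(l < n + d) T i' l * (l == d + j' :> nat)%:R.
      apply: eq_bigr => l _; rewrite [V _ _]mxE /g /= ltn_ord.
      case: (split_ordP l) => l' ->; by rewrite ?(block_mxEul, block_mxEur) mxE.
    have ltj : (d + j' < n + d)%N by have := ltn_ord j'; lia.
    rewrite (bigD1 (Ordinal ltj)) //= eqxx mulr1 big1 ?addr0 // => l.
    by rewrite -val_eqE /= => /negPf ->; rewrite mulr0.
  - rewrite -[RHS](TW i' j') //; apply: eq_bigr => l _.
    rewrite [V _ _]mxE /g /= ltnNge leq_addr addKn /=.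
    by case: (split_ordP l) => l' ->; rewrite ?(block_mxEul, block_mxEur) mxE.
  - rewrite (bigD1 (rshift n i')) //= block_mxEdr mxE eqxx mul1r.
    rewrite [V _ _]mxE /g /= ltn_ord big1 ?addr0 // => l.
    case: (split_ordP l) => l' -> ne; rewrite ?block_mxEdl ?block_mxEdr mxE ?mul0r //.
    by case: (eqVneq i' l') ne => [->|]; rewrite ?eqxx ?mul0r.
  - rewrite (bigD1 (rshift n i')) //= block_mxEdr mxE eqxx mul1r.
    rewrite [V _ _]mxE /g /= ltnNge leq_addr addKn /= big1 ?addr0 // => l.
    case: (split_ordP l) => l' -> ne; rewrite ?block_mxEdl ?block_mxEdr mxE ?mul0r //.
    by case: (eqVneq i' l') ne => [->|]; rewrite ?eqxx ?mul0r.
rewrite -detV -detG mulrC -det_mulmx GV det_lblock.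
rewrite (@det_unitrig _ _ (fun i j => T i (d + j)%N)) ?mul1r //.
- by move=> i j lt; rewrite T0 //; lia.
- by move=> i; rewrite addnC T1.
Qed.

(** The row J^(i+k) e_k ends at index i + 2k with coefficient 1, so the band has the even width
    [k.*2]. *)
Lemma hankel_motzkin_pow (k n : nat) (W : nat -> nat -> int) :
    (forall c m, (c < k.*2)%N -> iter (m + k) (step 1) (W c) k = 0) ->
  \det (\matrix_(i < k.*2, c < k.*2) W c i) * hankel (motzkin_pow k.+1) n
    = \det (\matrix_(i < k.*2, c < k.*2) W c (n + i)%N).
Proof.
move=> W0; pose T i := iter (i + k) (step 1) (delta k).
have out : forall l, (k < l)%N -> delta k l = 0 by exact: delta_out.
have -> : hankel (motzkin_pow k.+1) n = \det (\matrix_(i < n, j < n) T i j).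
  have -> : hankel (motzkin_pow k.+1) n
      = \det ((\matrix_(i < n, j < n) T i j) *m (\matrix_(i < n, j < n) walks 1 i j)^T).
    congr (\det _); apply/matrixP => i j; rewrite !mxE.
    under eq_bigr do rewrite !mxE mulrC.
    rewrite sum_walks // -iterD -walksE addnA [(j + i)%N]addnC.
    by rewrite /motzkin_pow (fps_exp_walks motzkin_walks).
  rewrite det_mulmx det_tr (@det_unitrig _ _ (walks 1)) ?mulr1 //.
    exact: walks_out.
  exact: walks_diag.
apply: (@det_minor_annihilated _ n _ T (fun i c => W c i)).
- by rewrite odd_double.
- by move=> i l lt; apply: (iter_step_out _ out); lia.
- move=> i; have -> : (i + k.*2 = k + (i + k))%N by lia.
  by rewrite /T (iter_step_lead _ _ out) /delta eqxx.
(* Moving the operator onto [W c] turns the pairing into (J^(i+k) W_c)_k, which is 0 by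
   hypothesis. *)
- move=> i c lti ltc; rewrite (iter_step_adjoint _ _ out); last by lia.
  by rewrite sum_delta ?W0 //; lia.
Qed.

(** * Explicit annihilated sequences and small determinants *)

Lemma eq_iter_step (c m : nat) (f g : nat -> int) :
  f =1 g -> iter m (step c) f =1 iter m (step c) g.
Proof.
by move=> fg; elim: m => [|m IH] // [|l]; rewrite /= /step !IH.
Qed.

Lemma iter_step_eigen (c m : nat) (a : int) (f : nat -> int) :
    (forall l, step c f l = a * f l) ->
  forall l, iter m (step c) f l = a ^+ m * f l.
Proof.
move=> fE; elim: m => [|m IH] l; first by rewrite mul1r.
rewrite iterSr (eq_iter_step _ _ fE) exprSr -mulrA -fE.
have -> : iter m (step c) (fun x => a * f x) l = a * iter m (step c) f l.
  elim: {IH} m l => [//|m IH] [|l]; rewrite /= /step !IH; ring.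
by rewrite IH fE; ring.
Qed.

(** At t = 0 and t = 2 the recursion has t - 1 = 2 cos(2 pi/3) and 2 cos(pi/3), so up to sign its
    solutions have period 3, and Taylor coefficients are polynomial on each class mod 3. *)
Definition interleave3 (a b c : nat -> int) (l : nat) : int :=
  nth 0 [:: a (l %/ 3)%N; b (l %/ 3)%N; c (l %/ 3)%N] (l %% 3).

Lemma interleave3E (a b c : nat -> int) (m : nat) :
  (interleave3 a b c (3 * m)%N = a m) * (interleave3 a b c (3 * m).+1 = b m)
  * (interleave3 a b c (3 * m).+2 = c m).
Proof.
have E i : (i < 3)%N -> ((i + 3 * m) %/ 3 = m)%N /\ ((i + 3 * m) %% 3 = i)%N by lia.
have [e0 e1] := E 0%N isT; have [e2 e3] := E 1%N isT; have [e4 e5] := E 2%N isT.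
rewrite !add0n !add1n !add2n in e0 e1 e2 e3 e4 e5.
by rewrite /interleave3 e0 e1 e2 e3 e4 e5.
Qed.

Lemma step_interleave3 (a b c a' b' c' : nat -> int) :
    a' 0%N = a 0%N + b 0%N ->
    (forall m, a' m.+1 = c m + a m.+1 + b m.+1) ->
    (forall m, b' m = a m + b m + c m) ->
    (forall m, c' m = b m + c m + a m.+1) ->
  step 1 (interleave3 a b c) =1 interleave3 a' b' c'.
Proof.
move=> E0 Ea Eb Ec l.
have S3 m : (3 * m.+1 = (3 * m).+3)%N by lia.
have [m] : exists m, (l = 3 * m \/ l = (3 * m).+1 \/ l = (3 * m).+2)%N.
  by exists (l %/ 3)%N; lia.
case=> [-> | [-> | ->]]; rewrite [RHS]interleave3E /step mulr1n.
- case: m => [|m]; last by rewrite !interleave3E Ea S3 !interleave3E.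
  by rewrite E0 !interleave3E add0r.
- by rewrite Eb !interleave3E.
- by rewrite Ec -S3 !interleave3E.
Qed.

(** Laplace expansion along the first two rows, by complementary 2 x 2 minors. *)
Lemma det_mx4 (R : comNzRingType) (g : nat -> nat -> R) :
  \det (\matrix_(i < 4, j < 4) g i j) =
    let up a b := g 0%N a * g 1%N b - g 0%N b * g 1%N a in
    let dn a b := g 2%N a * g 3%N b - g 2%N b * g 3%N a in
    up 0%N 1%N * dn 2%N 3%N - up 0%N 2%N * dn 1%N 3%N
    + up 0%N 3%N * dn 1%N 2%N + up 1%N 2%N * dn 0%N 3%N
    - up 1%N 3%N * dn 0%N 2%N + up 2%N 3%N * dn 0%N 1%N.
Proof.
rewrite (expand_det_row _ ord0) !big_ord_recl big_ord0 /cofactor.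
rewrite !(expand_det_row _ ord0) !big_ord_recl !big_ord0 /cofactor.
rewrite !(expand_det_row _ ord0) !big_ord_recl !big_ord0 /cofactor.
rewrite !det_mx11 !mxE /= /bump /=.
ring.
Qed.

Lemma det_mx2 (R : comNzRingType) (g : nat -> nat -> R) :
  \det (\matrix_(i < 2, j < 2) g i j)
    = g 0%N 0%N * g 1%N 1%N - g 0%N 1%N * g 1%N 0%N.
Proof.
rewrite (expand_det_row _ ord0) !big_ord_recl big_ord0 /cofactor.
rewrite !det_mx11 !mxE /= /bump /=; ring.
Qed.

(* With p_0 = 1, p_1 = t - 1 and p_(l+1) = (t - 1) p_l - p_(l-1), these are the
   sequences p_l(0), p_l'(0), p_l''(0) / 2, p_l(1) and p_l(2). *)
Definition value_at0 : nat -> int := interleave3 (fun=> 1) (fun=> -1) (fun=> 0).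
Definition taylor1_at0 : nat -> int :=
  interleave3 (fun m => m%:R) (fun m => m.+1%:R) (fun m => - m.+1%:R *+ 2).
Definition taylor2_at0 : nat -> int :=
  interleave3 (fun m => - 'C(m.+1, 2)%:R *+ 3) (fun m => 'C(m.+1, 2)%:R *+ 3)
              (fun m => m.+1%:R).
Definition value_at1 (l : nat) : int := nth 0 [:: 1; 0; -1; 0] (l %% 4).
Definition value_at2 : nat -> int :=
  interleave3 (fun m => (-1) ^+ m) (fun m => (-1) ^+ m) (fun=> 0).

Lemma step_value_at0 l : step 1 value_at0 l = 0 * value_at0 l.
Proof.
rewrite (@step_interleave3 _ _ _ (fun=> 0) (fun=> 0) (fun=> 0)) //.
by rewrite /interleave3 mul0r; move: (l %% 3)%N => [|[|[|r]]] /=; rewrite ?nth_nil.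
Qed.

Lemma step_taylor1_at0 : step 1 taylor1_at0 =1 value_at0.
Proof. by apply: step_interleave3 => // m; lia. Qed.

Lemma step_taylor2_at0 : step 1 taylor2_at0 =1 taylor1_at0.
Proof. by apply: step_interleave3 => // m; rewrite ?binS ?bin1 ?bin0; lia. Qed.

Lemma step_value_at1 l : step 1 value_at1 l = 1 * value_at1 l.
Proof.
rewrite mul1r /step mulr1n; case: l => [|l]; first by [].
rewrite addrAC -[RHS]add0r; congr (_ + _); rewrite /value_at1.
have -> : (l.+2 %% 4 = (l %% 4 + 2) %% 4)%N by lia.
have : (l %% 4 < 4)%N by lia.
by move: (l %% 4)%N => [|[|[|[|r]]]].
Qed.

Lemma step_value_at2 l : step 1 value_at2 l = 2 * value_at2 l.
Proof.
rewrite (@step_interleave3 _ _ _ (fun m => 2 * (-1) ^+ m)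
          (fun m => 2 * (-1) ^+ m) (fun=> 0)) //; try by move=> m; rewrite ?exprS; ring.
by rewrite /value_at2 /interleave3; move: (l %% 3)%N => [|[|[|r]]] /=; rewrite ?nth_nil ?mulr0.
Qed.

(** * Evaluation of the Hankel determinants of the square and the cube *)

Lemma hankel_motzkin_pow2 n :
  hankel (motzkin_pow 2) n
    = value_at0 n * value_at1 n.+1 - value_at1 n * value_at0 n.+1.
Proof.
pose W c := if c == 0%N then value_at0 else value_at1.
have : \det (\matrix_(i < 2, c < 2) W c i) * hankel (motzkin_pow 2) n
     = \det (\matrix_(i < 2, c < 2) W c (n + i)%N).
  apply: (@hankel_motzkin_pow 1) => -[|[|c]] // m _; rewrite addn1.
    by rewrite (iter_step_eigen _ step_value_at0) exprS !mul0r.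
  (* The eigenvalue 1 is not nilpotent, but [value_at1] vanishes at index 1. *)
  by rewrite (iter_step_eigen _ step_value_at1) mulr0.
rewrite (det_mx2 (fun i c => W c i)) (det_mx2 (fun i c => W c (n + i)%N)).
by rewrite [X in X * _ = _](_ : _ = 1) // mul1r addn0 addn1 => ->.
Qed.

Lemma hankel_motzkin_pow3 n (c0 := value_at0) (c1 := taylor1_at0)
    (c2 := taylor2_at0) (c3 := value_at2) :
  let up a b := a n * b n.+1 - b n * a n.+1 in
  let dn a b := a n.+2 * b n.+3 - b n.+2 * a n.+3 in
  8 * hankel (motzkin_pow 3) n =
    up c0 c1 * dn c2 c3 - up c0 c2 * dn c1 c3 + up c0 c3 * dn c1 c2
    + up c1 c2 * dn c0 c3 - up c1 c3 * dn c0 c2 + up c2 c3 * dn c0 c1.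
Proof.
pose W := nth c3 [:: c0; c1; c2].
have : \det (\matrix_(i < 4, c < 4) W c i) * hankel (motzkin_pow 3) n
     = \det (\matrix_(i < 4, c < 4) W c (n + i)%N).
  have iter0 m l : iter m.+1 (step 1) value_at0 l = 0.
    by rewrite (iter_step_eigen _ step_value_at0) exprS !mul0r.
  apply: (@hankel_motzkin_pow 2) => -[|[|[|[|c]]]] // m _; rewrite addn2 /W /=.
  - by rewrite -!iterS iter0.
  - by rewrite -!iterS iterSr (eq_iter_step _ _ step_taylor1_at0) iter0.
  (* Two applications of J lead to [value_at0], which vanishes at index 2; any further one gives
     0. *)
  - rewrite -!iterS !iterSr (eq_iter_step _ _ (eq_iter_step 1 1 step_taylor2_at0)).
    by rewrite (eq_iter_step _ _ step_taylor1_at0); case: m => [|m] //; rewrite iter0.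
  - by rewrite -!iterS (iter_step_eigen _ step_value_at2) mulr0.
rewrite (det_mx4 (fun i c => W c i)) (det_mx4 (fun i c => W c (n + i)%N)) /=.
(* The p_l are monic, so the initial determinant is the confluent Vandermonde determinant of the
   nodes 0, 0, 0, 2, namely 2^3 = 8. *)
by rewrite ![(n + _)%N]addnC => <-; congr (_ * _).
Qed.

Lemma hankel_motzkin_pow3_mod3 m :
  [/\ hankel (motzkin_pow 3) (3 * m) = (-1) ^+ m * (m.+1)%:R ^+ 2,
      hankel (motzkin_pow 3) (3 * m + 1) = (-1) ^+ m * (m.+1)%:R ^+ 2
    & hankel (motzkin_pow 3) (3 * m + 2) = 0].
Proof.
(* With this relation [ring] can compare expressions in which [m] and the binomial ['C(m.+1, 2)]
   both occur as atoms. *)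
have tri : m%:R ^+ 2 = 'C(m.+1, 2)%:R *+ 2 - m%:R :> int.
  apply/eqP; rewrite eq_sym subr_eq -mulrnA -natrX -natrD; apply/eqP.
  by congr _%:R; rewrite bin2 /= muln2 halfK oddM andNb subn0 mulSn addnC.
have triS : 'C(m.+2, 2)%:R = 'C(m.+1, 2)%:R + m%:R + 1 :> int.
  by rewrite binS bin1 natrD -natr1 addrA.
have [x1 x2] : m.+1%:R = m%:R + 1 :> int /\ m.+2%:R = m%:R + 2 :> int by lia.
have S3 : (3 * m).+3 = (3 * m.+1)%N by lia.
have inj8 : injective ( *%R (8 : int)) by apply: mulfI.
rewrite addn1 addn2; split; apply: inj8; rewrite hankel_motzkin_pow3 ?S3;
  rewrite /value_at0 /taylor1_at0 /taylor2_at0 /value_at2 !interleave3E;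
  rewrite triS exprS x1 ?x2 ?mulr0.
all: ring: tri.
Qed.

Theorem theorem1 :
  (forall n : nat,
     [/\ (n %% 12)%N \in [:: 0; 1; 2; 3]%N -> hankel (motzkin_pow 2) n = 1,
         (n %% 12)%N \in [:: 4; 5; 10; 11]%N -> hankel (motzkin_pow 2) n = 0
       & (n %% 12)%N \in [:: 6; 7; 8; 9]%N -> hankel (motzkin_pow 2) n = -1])
  /\
  (forall n : nat,
     [/\ hankel (motzkin_pow 3) (3 * n) = (-1) ^+ n * (n.+1)%:R ^+ 2,
         hankel (motzkin_pow 3) (3 * n + 1) = (-1) ^+ n * (n.+1)%:R ^+ 2
       & hankel (motzkin_pow 3) (3 * n + 2) = 0]).
Proof.
split=> n; last exact: hankel_motzkin_pow3_mod3.
have at0E l : value_at0 l = nth 0 [:: 1; -1; 0] (l %% 3) by [].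
rewrite hankel_motzkin_pow2 !at0E /value_at1.
(* The sequences have periods 3 and 4, so only n mod 12 matters and twelve cases remain. *)
rewrite -(@modn_dvdm 12 n 3) // -(@modn_dvdm 12 n 4) //.
have -> : (n.+1 %% 3 = (n %% 12).+1 %% 3)%N by lia.
have -> : (n.+1 %% 4 = (n %% 12).+1 %% 4)%N by lia.
have : (n %% 12 < 12)%N by rewrite ltn_mod.
by move: (n %% 12)%N; do 12![case=> //].
Qed.
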